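(* Fix an integer $k\ge1$. There exists a flat torus represented by a point $(a_k^\star,b_k^\star)\in F$ attaining the supremum of $\Lambda_k(a,b)$ over $(a,b)\in F$. Furthermore, the maximal value $$\tilde\Lambda_k=\max\left\{\Lambda_k(a,b)\colon (a,b)\in F\ \text{with}\ a^2+b^2\ge\left(\left\lceil\tfrac k2\right\rceil-1\right)^2\right\}$$ is given by $$\tilde\Lambda_k=\frac{4\pi^2\left\lceil\frac k2\right\rceil^2}{\sqrt{\left\lceil\frac k2\right\rceil^2-\frac14}},$$ and it is attained by the $(a,b)$-flat torus with $(a,b)=\left(\frac12,\sqrt{\left\lceil\frac k2\right\rceil^2-\frac14}\right)$. For this torus, the optimal value is obtained only for the integer lattice values $$(c_1,c_2)=(1,0),\ (-1,0),\ (1,1),\ (-1,-1),\ \left(0,\left\lceil\tfrac k2\right\rceil\right),\ \left(0,-\left\lceil\tfrac k2\right\rceil\right)$$ (that is, these are exactly the $(c_1,c_2)\in\mathbb Z^2$ with $\Lambda(a,b;c_1,c_2)=\tilde\Lambda_k$), and thus the maximal eigenvalue has multiplicity $6$.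
   Context: For $a\in\mathbb R$ and $b>0$, the $(a,b)$-flat torus is the quotient $\mathbb R^2/L$ of the Euclidean plane by the lattice $L$ generated by $(1,0)^t$ and $(a,b)^t$; its volume is $b$. $\lambda_k(a,b)$ denotes the $k$-th eigenvalue of its (positive) Laplacian, counted with multiplicity and starting from $\lambda_0=0$, and $\Lambda_k(a,b):=b\cdot\lambda_k(a,b)$ is the volume-normalized eigenvalue. Explicitly, the volume-normalized eigenvalues, with multiplicity, are the numbers $$\Lambda(a,b;c_1,c_2):=4\pi^2\left[\frac{(c_1a-c_2)^2}{b}+c_1^2b\right],\qquad (c_1,c_2)\in\mathbb Z^2,$$ so that $$\Lambda_k(a,b)=\min_{\substack{E\subset\mathbb Z^2\\|E|=k+1}}\ \max_{(c_1,c_2)\in E}\Lambda(a,b;c_1,c_2).$$ The set $F$ is $$F:=\{(a,b)\in\mathbb R^2\colon b>0,\ a\in(-1/2,1/2],\ a^2+b^2\ge1\}.$$ $\lceil x\rceil$ denotes the smallest integer not less than $x$. *)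

(* Defs.v *)
From HB Require Import structures.
From mathcomp Require Import all_boot all_order all_algebra finmap zify ring lra.
From mathcomp Require Import all_classical all_reals all_analysis.

Set Implicit Arguments.
Unset Strict Implicit.
Unset Printing Implicit Defensive.

Import Order.TTheory GRing.Theory Num.Theory.

Local Open Scope classical_set_scope.
Local Open Scope ring_scope.

(* Volume-normalized eigenvalue of the Laplacian of R^2/L on the (a,b)-flat
   torus, where L is spanned by (1,0) and (a,b).  The dual lattice consists of
   the vectors xi = (c1, (c2 - c1 a) / b), or equivalently its index (c1, c2);
   the eigenvalue of x |-> exp (2 i pi <xi, x>) is 4 pi^2 |xi|^2, and the
   volume b is a factor of the value below. *)
Definition Lambda (R : realType) (a b : R) (c1 c2 : int) : R :=
  4 * pi ^+ 2 * ((c1%:~R * a - c2%:~R) ^+ 2 / b + c1%:~R ^+ 2 * b).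

(* The default 0 of the maximum is harmless: E is nonempty and, for b > 0,
   every value is nonnegative. *)
Definition Lambda_max (R : realType) (a b : R) (E : {fset int * int}) : R :=
  \big[Num.max/0]_(c <- E) Lambda a b c.1 c.2.

(* k-th eigenvalue counted with multiplicity, Lambda_k 0 being the zero one.
   For b > 0 the infimum is a minimum: see Lambda_k_min. *)
Definition Lambda_k (R : realType) (k : nat) (a b : R) : R :=
  inf [set Lambda_max a b E | E in [set E : {fset int * int} | #|` E| = k.+1]].

Definition F (R : realType) : set (R * R) :=
  [set p | [/\ 0 < p.2, - (1 / 2) < p.1 <= 1 / 2 & 1 <= p.1 ^+ 2 + p.2 ^+ 2]].

Definition is_maximum (R : realType) (A : set R) (x : R) : Prop :=
  A x /\ ubound A x.

Lemma Lambda_ge0 (R : realType) (a b : R) c1 c2 : 0 < b -> 0 <= Lambda a b c1 c2.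
Proof.
move=> b0; rewrite /Lambda; apply: mulr_ge0.
  by apply: mulr_ge0 => //; exact: sqr_ge0.
apply: addr_ge0; first by rewrite divr_ge0 ?sqr_ge0// ltW.
by rewrite mulr_ge0 ?sqr_ge0// ltW.
Qed.

Lemma finite_int_ball (R : realType) (B : R) :
  finite_set [set z : int | `|z%:~R| <= B :> R].
Proof.
pose n := Num.bound `|B|.
apply: (@sub_finite_set _ _ [set i%:Z - n%:Z | i in `I_(n + n).+1]); last first.
  exact/finite_image/finite_II.
move=> z /= zB.
have : (`|z|%N <= n)%N.
  rewrite -(ler_nat R) natr_absz intr_norm (le_trans zB)// (le_trans (ler_norm _))//.
  by apply: ltW; apply: archi_boundP.
move=> zn; exists (absz (z + n%:Z)); last by lia.
by rewrite /mkset; lia.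
Qed.

Lemma finite_Lambda_le (R : realType) (a b M : R) : 0 < b ->
  finite_set [set c : int * int | Lambda a b c.1 c.2 <= M].
Proof.
move=> b0; pose N := M / (4 * pi ^+ 2).
have p0 : 0 < 4 * pi ^+ 2 :> R by rewrite mulr_gt0// exprn_gt0// pi_gt0.
pose B1 := N / b + 1; pose B2 := B1 * `|a| + (N * b + 1).
have normB (x y : R) : x ^+ 2 <= y -> `|x| <= y + 1.
  by rewrite -real_normK ?num_real// => h; nra.
apply: (@sub_finite_set _ _ ([set z : int | `|z%:~R| <= B1] `*`
                            [set z : int | `|z%:~R| <= B2])); last first.
  by apply: finite_setX; exact: finite_int_ball.
move=> [c1 c2] /=; rewrite /Lambda mulrC -ler_pdivlMr// -/N => h.
have [s1 s2] : c1%:~R ^+ 2 <= N / b /\ (c1%:~R * a - c2%:~R) ^+ 2 <= N * b.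
  split; [rewrite ler_pdivlMr//|rewrite -ler_pdivrMr//]; apply: le_trans h.
    by rewrite lerDr divr_ge0 ?sqr_ge0// ltW.
  by rewrite lerDl mulr_ge0 ?sqr_ge0// ltW.
have h1 : `|c1%:~R| <= B1 by exact: normB.
split=> //=; have {}s2 := normB _ _ s2.
rewrite (_ : c2%:~R = c1%:~R * a - (c1%:~R * a - c2%:~R)); last by ring.
by rewrite (le_trans (ler_normB _ _))// lerD// normrM ler_wpM2r.
Qed.

Lemma finite_has_min (R : realType) (A : set R) : finite_set A -> A !=set0 ->
  exists x, A x /\ lbound A x.
Proof.
move=> /finite_seqP[s ->]; elim: s => [|x s IHs] [y]//= _.
case: s IHs => [_|z s IHs].
  by exists x; split=> [|w]; rewrite /= ?mem_head// inE => /eqP->.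
have [|m [ms mlb]] := IHs; first by exists z; rewrite /= mem_head.
have [xm|mx] := leP x m.
  exists x; split=> [|w]; first by rewrite /= mem_head.
  by rewrite /= in_cons => /predU1P[->//|/mlb]; exact: le_trans.
exists m; split=> [|w]; first by rewrite /= in_cons ms orbT.
by rewrite /= in_cons => /predU1P[->|/mlb//]; exact: ltW.
Qed.

Lemma Lambda_k_min (R : realType) (k : nat) (a b : R) : 0 < b ->
  let S := [set Lambda_max a b E | E in [set E : {fset int * int} | #|` E| = k.+1]] in
  S (Lambda_k k a b) /\ lbound S (Lambda_k k a b).
Proof.
move=> b0 S.
have S0 : lbound S 0.
  by move=> _ [E _ <-]; exact: bigmax_ge_id.
suff [x [Sx lbx]] : exists x, S x /\ lbound S x.
  suff -> : Lambda_k k a b = x by [].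
  apply/eqP; rewrite eq_le; apply/andP; split.
    by apply: ge_inf => //; exists 0.
  by apply: lb_le_inf => //; exists x.
have [M SM] : S !=set0.
  pose E : {fset int * int} := [fset (i%:Z, 0) | i in iota 0 k.+1]%fset.
  exists (Lambda_max a b E), E => //=.
  rewrite card_imfset; last by move=> i j [].
  by rewrite -[RHS](size_iota 0) -[in RHS](undup_id (iota_uniq 0 k.+1)).
have [||x [[Sx xM] lbx]] := @finite_has_min _ (S `&` [set x | x <= M]).
- apply: (@sub_finite_set _ _ (0 |` [set Lambda a b c.1 c.2 |
      c in [set c : int * int | Lambda a b c.1 c.2 <= M]])); last first.
    rewrite finite_setU; split; first exact: finite_set1.
    exact/finite_image/finite_Lambda_le.
  move=> _ [[E _ <-] /= EM].
  have : (0 |` [set Lambda a b c.1 c.2 | c in [set` E]]) (Lambda_max a b E).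
    rewrite /Lambda_max big_seq; apply: big_ind => [|x y xS yS|c cE]; first by left.
      by rewrite maxEle; case: ifP.
    by right; exists c.
  by case=> [|[c _ cE]]; [left|right; exists c => //=; rewrite cE].
- by exists M; split=> /=.
exists x; split=> // y Sy; have [yM|/ltW My] := leP y M; first exact: lbx.
exact: le_trans My.
Qed.

(* Main.v *)
Require Import Defs.
From mathcomp Require Import all_boot all_order all_algebra finmap.
From mathcomp Require Import all_classical all_reals all_analysis.
From mathcomp Require Import zify ring lra.

Set Implicit Arguments.
Unset Strict Implicit.
Unset Printing Implicit Defensive.

Import Order.TTheory GRing.Theory Num.Theory.
Import numFieldNormedType.Exports.
Local Open Scope classical_set_scope.
Local Open Scope ring_scope.

(** Write n for the ceiling of k / 2, so that k is 2n - 1 or 2n, and measure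
    eigenvalues of the (a, b)-torus by the quadratic form
    q(c) = (c1 a - c2)^2 + (c1 b)^2, with Lambda = (4 pi^2 / b) q.

    Upper bound.  An upper bound on the k-th eigenvalue needs only k + 1
    lattice points with small q (Lambda_k_le), and two families of 2n + 1
    points suffice.  The points (0, j) with |j| <= n give q <= n^2
    (Lambda_k_le_axis).  The points (0, j) with |j| <= n - 1, together with
    (1, 0) and (-1, 0), give q <= a^2 + b^2 as soon as
    (n - 1)^2 <= a^2 + b^2 (Lambda_k_le_short).  The first family is used
    when a^2 + b^2 > n^2, the second otherwise; as a^2 <= 1/4, each bound is
    largest where a = 1/2 and a^2 + b^2 = n^2, the point where the two agree
    (Lambda_k_le_optimum).

    Value at that point.  For a = 1/2 and b^2 = n^2 - 1/4, the form is
    c1^2 n^2 + c2^2 - c1 c2.  Only the 2n - 1 points (0, j) with |j| < n have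
    q < n^2, so the eigenvalues of index 2n - 1 and 2n are both the level
    q = n^2 (Lambda_k_star), which is attained at six points
    (Lambda_star_eq).

    Existence of a maximum over F.  The k-th eigenvalue is a minimum over
    finite sets E of maxima of continuous functions, hence upper
    semicontinuous (usc_Lambda_k), and so has a maximum on compact sets
    (usc_compact_max).  The bound (4 pi^2 / b) n^2 shows that a torus higher
    than the optimal one above cannot beat it, so F may be cut at that height.
    The edge a = -1/2, which has to be added to make the region compact, is
    folded onto a = 1/2 by a reflection (Lambda_k_opp). *)

(** * Upper semicontinuous functions on compact sets *)

(** Without a maximum, each point of K lies in an open set on which f stays
    below some value f q with q in K, hence below f i for every i in the
    superlevel set of q.  The superlevel sets generate a proper filter G, and
    compactness makes f x < f i hold for all x in K at once, i being G-near;
    such an i can be chosen in K, and x := i is absurd. *)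
Lemma usc_compact_max (T : topologicalType) (R : realType) (f : T -> R)
    (K : set T) : K !=set0 -> compact K ->
  (forall x y, K x -> f x < y -> \forall z \near x, f z < y) ->
  exists2 x, K x & forall z, K z -> f z <= f x.
Proof.
move=> [x0 Kx0] /compact_near_coveringP cK usc; apply: contrapT => nomax.
have above x : K x -> exists2 z, K z & f x < f z.
  move=> Kx; apply: contrapT => noz; apply: nomax; exists x => // z Kz.
  by rewrite leNgt; apply/negP => xz; apply: noz; exists z.
pose G := filter_from K (fun q => [set i | K i /\ f q <= f i]).
have FG : Filter G.
  apply: filter_from_filter; first by exists x0.
  move=> p q Kp Kq; have [pq|/ltW qp] := leP (f p) (f q).
    by exists q => // i [Ki qi]; do 2!split=> //; exact: le_trans qi.
  by exists p => // i [Ki pi]; do 2!split=> //; exact: le_trans pi.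
have [x Kx|q Kq /(_ q)] := cK T G (fun i x => f x < f i) FG.
  have [q Kq xq] := above x Kx.
  exists ([set z | f z < f q], [set i | K i /\ f q <= f i]).
    by split; [exact: usc | exists q].
  by move=> [z i] [/= zq [_ qi]]; exact: lt_le_trans qi.
by move=> /(_ (conj Kq (lexx _)) _ Kq); rewrite ltxx.
Qed.

Lemma near_all_in (T : Type) (F : set_system T) (I : eqType) (s : seq I)
    (P : I -> T -> Prop) : Filter F ->
  {in s, forall i, \forall x \near F, P i x} ->
  \forall x \near F, {in s, forall i, P i x}.
Proof.
move=> FF; elim: s => [_|i s IHs sP]; first by near=> x => ?; rewrite in_nil.
have Pi := sP i (mem_head _ _).
have /IHs Ps : {in s, forall j, \forall x \near F, P j x}.
  by move=> j js; apply: sP; rewrite inE js orbT.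
apply: filterS2 Pi Ps => x Pix Psx j.
by rewrite inE => /predU1P[->|/Psx].
Unshelve. all: by end_near. Qed.

(** * Eigenvalues through a quadratic form *)

(** The squared length of b times the dual vector with index c.  Unlike
    [Lambda] it is polynomial in a and b. *)
Definition qform (R : realType) (a b : R) (c : int * int) : R :=
  (c.1%:~R * a - c.2%:~R) ^+ 2 + (c.1%:~R * b) ^+ 2.

(** The normalized eigenvalue of a torus of height b at the points where
    [qform] equals t. *)
Definition level (R : realType) (b t : R) : R := 4 * pi ^+ 2 * t / b.

Section Spectrum.
Context {R : realType}.
Implicit Types (a b t x : R) (c : int * int) (s : seq (int * int)).

Lemma LambdaE a b c : 0 < b -> Lambda a b c.1 c.2 = level b (qform a b c).
Proof. by move=> b0; rewrite /Lambda /level /qform; field; rewrite gt_eqF. Qed.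

Lemma ler_level b t u : 0 < b -> (level b t <= level b u) = (t <= u).
Proof.
move=> b0; rewrite /level ler_pM2r ?invr_gt0// ler_pM2l//.
by rewrite mulr_gt0// exprn_gt0// pi_gt0.
Qed.

Lemma ltr_level b t u : 0 < b -> (level b t < level b u) = (t < u).
Proof. by move=> b0; rewrite !ltNge ler_level. Qed.

Lemma level_eq b t u : 0 < b -> (level b t == level b u) = (t == u).
Proof. by move=> b0; rewrite !eq_le !ler_level. Qed.

(** Two tori are compared through squares: this removes the square root that
    defines the optimal height. *)
Lemma ler_level2 b b' t t' : 0 < b -> 0 < b' -> 0 <= t -> 0 <= t' ->
  (level b t <= level b' t') = (t ^+ 2 * b' ^+ 2 <= t' ^+ 2 * b ^+ 2).
Proof.
move=> b0 b'0 t0 t'0; rewrite /level -!(mulrA (4 * _)) ler_pM2l; last first.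
  by rewrite mulr_gt0// exprn_gt0// pi_gt0.
rewrite ler_pdivrMr// mulrAC ler_pdivlMr//.
by rewrite -!exprMn ler_pXn2r// nnegrE mulr_ge0// ltW.
Qed.

Lemma Lambda_le_max a b (E : {fset int * int}) c : c \in E ->
  Lambda a b c.1 c.2 <= Lambda_max a b E.
Proof.
move=> cE.
by apply: (@le_bigmax_seq _ _ _ _ _ c _ (fun d => Lambda a b d.1 d.2)).
Qed.

(** * Bounds on the k-th eigenvalue *)

Lemma Lambda_k_le {k a b x s} : 0 < b -> uniq s -> (k < size s)%N ->
  {in s, forall c, Lambda a b c.1 c.2 <= x} -> Lambda_k k a b <= x.
Proof.
move=> b0 us ks sx; have [_ lb] := @Lambda_k_min R k a b b0.
have x0 : 0 <= x.
  case: s ks sx {us} => // c s _ sx.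
  by apply: le_trans (sx c (mem_head _ _)); exact: Lambda_ge0.
apply: (@le_trans _ _ (Lambda_max a b [fset c in take k.+1 s]%fset)).
  apply: lb; eexists; last by [].
  by rewrite /= card_fseq undup_id ?take_uniq// size_takel.
rewrite /Lambda_max big_seq; apply: bigmax_le => // c.
by rewrite !inE => /mem_take /sx.
Qed.

Lemma Lambda_k_ge {k a b x s} : 0 < b -> (size s <= k)%N ->
  (forall c, Lambda a b c.1 c.2 < x -> c \in s) -> x <= Lambda_k k a b.
Proof.
move=> b0 sk sx; have [[E /= Ek <-] _] := @Lambda_k_min R k a b b0.
rewrite leNgt; apply/negP => Ex.
have /uniq_leq_size : {subset enum_fset E <= s}.
  move=> c cE; apply: sx; apply: le_lt_trans Ex.
  exact: Lambda_le_max.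
by move=> /(_ (fset_uniq E)); rewrite Ek ltnNge sk.
Qed.

(** The tori with shears a and -a are mirror images of each other; on the
    lattice the mirror is c2 |-> - c2. *)
Lemma Lambda_k_opp k a b : 0 < b -> Lambda_k k (- a) b <= Lambda_k k a b.
Proof.
move=> b0; have [[E /= Ek Ea] _] := @Lambda_k_min R k a b b0.
have inj : injective (fun c : int * int => (c.1, - c.2)).
  by move=> [c1 c2] [d1 d2] [-> /oppr_inj ->].
apply: (@Lambda_k_le _ _ _ _ [seq (c.1, - c.2) | c <- enum_fset E]) => //.
- by rewrite map_inj_uniq// fset_uniq.
- by rewrite size_map Ek.
move=> _ /mapP[c cE ->]; rewrite -Ea.
rewrite [leLHS](_ : _ = Lambda a b c.1 c.2); first exact: Lambda_le_max.
by rewrite /Lambda/= rmorphN/=; congr (_ * (_ / _ + _)); ring.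
Qed.

Lemma continuous_Lambda c (p : R * R) : 0 < p.2 ->
  {for p, continuous (fun q : R * R => Lambda q.1 q.2 c.1 c.2)}.
Proof.
move=> p0; rewrite /Lambda; apply: cvgM; first exact: cvg_cst.
have c1 : q.1 @[q --> p] --> p.1 by exact: cvg_fst.
have c2 : q.2 @[q --> p] --> p.2 by exact: cvg_snd.
apply: cvgD; last by apply: cvgM => //; exact: cvg_cst.
apply: cvgM; last by apply: cvgV => //; rewrite gt_eqF.
have d : c.1%:~R * q.1 - c.2%:~R @[q --> p] --> c.1%:~R * p.1 - c.2%:~R.
  by apply: cvgB; [apply: cvgM => //|]; exact: cvg_cst.
by rewrite expr2; apply: cvgM.
Qed.

(** A set E that realizes the minimum at p still bounds the k-th eigenvalue at
    nearby points, where the finitely many [Lambda] over E have barely moved. *)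
Lemma usc_Lambda_k k (p : R * R) x : 0 < p.2 -> Lambda_k k p.1 p.2 < x ->
  \forall q \near p, Lambda_k k q.1 q.2 < x.
Proof.
move=> p0; have [[E /= Ek <-] _] := @Lambda_k_min R k p.1 p.2 p0 => Ex.
have x0 : 0 < x by apply: le_lt_trans Ex; exact: bigmax_ge_id.
have near_pos : \forall q \near p, 0 < q.2.
  have c2 : q.2 @[q --> p] --> p.2 by exact: cvg_snd.
  exact: (@cvgr_gt _ _ _ (nbhs_filter p) _ _ c2 _ p0).
have near_E : \forall q \near p,
    {in enum_fset E, forall c, Lambda q.1 q.2 c.1 c.2 < x}.
  apply: (near_all_in (nbhs_filter p)) => c cE.
  apply: (@cvgr_lt _ _ _ (nbhs_filter p) _ _ (continuous_Lambda (c := c) p0)).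
  by apply: le_lt_trans Ex; exact: Lambda_le_max.
near=> q.
have q0 : 0 < q.2 by near: q.
have [_ lb] := @Lambda_k_min R k q.1 q.2 q0.
apply: (@le_lt_trans _ _ (Lambda_max q.1 q.2 E)); first by apply: lb; exists E.
rewrite /Lambda_max big_seq; apply: bigmax_lt => //.
by near: q.
Unshelve. all: by end_near. Qed.

Lemma compact_region (B : R) : compact
  ((`[- (1 / 2), 1 / 2]%classic `*` `[1 / 2, B]%classic) `&`
   [set p : R * R | 1 <= p.1 ^+ 2 + p.2 ^+ 2]).
Proof.
apply: compact_closedI; first by apply: compact_setX; exact: segment_compact.
rewrite -[X in closed X]/((fun p : R * R => p.1 ^+ 2 + p.2 ^+ 2) @^-1`
  [set x | 1 <= x]).
apply: preimage_closed => [p _|]; last exact: closed_ge.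
have c1 : q.1 @[q --> p] --> p.1 by exact: cvg_fst.
have c2 : q.2 @[q --> p] --> p.2 by exact: cvg_snd.
by apply: cvgD; rewrite expr2; apply: cvgM.
Qed.

(** The constant 1/2 is a convenient height below the minimum sqrt 3 / 2 of F:
    it keeps the compact region away from b = 0. *)
Lemma F_bounds (p : R * R) : F p -> p.1 ^+ 2 <= 1 / 4 /\ 1 / 2 <= p.2.
Proof.
move=> [p2 /andP[l u] h]; have p14 : p.1 ^+ 2 <= 1 / 4 by nra.
by split=> //; nra.
Qed.

End Spectrum.

(** * The points (0, j) with |j| <= n *)

Definition axis (n : nat) : seq (int * int) :=
  [seq (0, i%:Z - n%:Z) | i <- iota 0 n.*2.+1].

Lemma axis_uniq n : uniq (axis n).
Proof. by rewrite map_inj_uniq ?iota_uniq// => i j []; lia. Qed.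

Lemma size_axis n : size (axis n) = n.*2.+1.
Proof. by rewrite size_map size_iota. Qed.

Lemma mem_axis n c : (c \in axis n) = (c.1 == 0) && (`|c.2| <= n%:Z).
Proof.
apply/mapP/andP => [[i]|[]].
  by rewrite mem_iota => ii ->; split=> //=; lia.
case: c => [c1 c2] /= /eqP-> c2n; exists (absz (c2 + n%:Z)).
  by rewrite -[0%N :: _]/(iota 0 n.*2.+1) mem_iota; lia.
by congr (_, _); lia.
Qed.

Lemma ceil_half (R : realType) k : Num.ceil (k%:R / 2 : R) = (uphalf k)%:Z.
Proof.
apply: ceil_def; rewrite ltr_pdivlMr// ler_pdivrMr//.
rewrite -[k%:R]/(k%:Z%:~R) -[2%R]/(2%:Z%:~R) -!intrM ltr_int ler_int.
by lia.
Qed.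

(** * The optimal torus *)

Section Optimum.
Context {R : realType} (n : nat) (n0 : (0 < n)%N).
Let N : R := n%:R ^+ 2.
Let bstar : R := Num.sqrt (N - 1 / 4).

Let N_ge1 : 1 <= N.
Proof. by rewrite /N expr_ge1// ler1n. Qed.

Let N_int : N = (n%:Z ^+ 2)%:~R.
Proof. by rewrite rmorphXn. Qed.

Let bstar2 : bstar ^+ 2 = N - 1 / 4.
Proof. by rewrite sqr_sqrtr//; have := N_ge1; lra. Qed.

Let bstar_gt0 : 0 < bstar.
Proof. by rewrite sqrtr_gt0; have := N_ge1; lra. Qed.

Lemma Lambda_k_le_axis k (a b : R) : 0 < b -> (k <= n.*2)%N ->
  Lambda_k k a b <= level b N.
Proof.
move=> b0 kn; apply: (@Lambda_k_le _ _ _ _ _ (axis n)) => //.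
- exact: axis_uniq.
- by rewrite size_axis.
move=> [c1 c2]; rewrite mem_axis => /andP[/= /eqP-> c2n].
rewrite (@LambdaE _ _ _ (0, c2))// ler_level// /qform/=.
rewrite !mul0r expr0n addr0 sub0r sqrrN -[_ ^+ 2]real_normK ?num_real//.
by rewrite ler_pXn2r ?nnegrE// -intr_norm -[n%:R]/(n%:Z%:~R) ler_int.
Qed.

(** The point (1, 0) beats (0, n) exactly when a^2 + b^2 < n^2. *)
Lemma Lambda_k_le_short k (a b : R) : 0 < b -> (k <= n.*2)%N ->
  (n%:R - 1) ^+ 2 <= a ^+ 2 + b ^+ 2 ->
  Lambda_k k a b <= level b (a ^+ 2 + b ^+ 2).
Proof.
move=> b0 kn ab.
apply: (@Lambda_k_le _ _ _ _ _ [:: (1, 0), (-1, 0) & axis n.-1]) => //.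
- by rewrite 2!cons_uniq axis_uniq in_cons negb_or !mem_axis.
- by rewrite -[size _]/(size (axis n.-1)).+2 size_axis; lia.
move=> [c1 c2]; rewrite (@LambdaE _ _ _ (c1, c2))// ler_level// /qform/=.
rewrite in_cons => /predU1P[[-> ->]|]; last rewrite in_cons => /predU1P[[-> ->]|].
- by rewrite le_eqVlt; apply/orP; left; apply/eqP; ring.
- by rewrite le_eqVlt; apply/orP; left; apply/eqP; ring.
rewrite mem_axis => /andP[/= /eqP-> c2n]; apply: le_trans ab.
rewrite !mul0r expr0n addr0 sub0r sqrrN -[_ ^+ 2]real_normK ?num_real//.
have -> : n%:R - 1 = (n.-1)%:R :> R by rewrite -subn1 natrB.
by rewrite ler_pXn2r ?nnegrE// -intr_norm -[n.-1%:R]/(n.-1%:Z%:~R) ler_int.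
Qed.

Lemma Lambda_k_le_optimum k (a b : R) : 0 < b -> (k <= n.*2)%N ->
  a ^+ 2 <= 1 / 4 -> 1 <= a ^+ 2 + b ^+ 2 ->
  (n%:R - 1) ^+ 2 <= a ^+ 2 + b ^+ 2 ->
  Lambda_k k a b <= level bstar N.
Proof.
move=> b0 kn a4 ab1 abn; have N1 := N_ge1.
have [abN|Nab] := leP (a ^+ 2 + b ^+ 2) N.
  apply: (le_trans (Lambda_k_le_short _ _ _)) => //.
  rewrite ler_level2//; [|lra|lra].
  rewrite bstar2; set s := a ^+ 2 + b ^+ 2 in abn ab1 abN *.
  have sb : s - 1 / 4 <= b ^+ 2 by rewrite /s; lra.
  apply: (@le_trans _ _ (N ^+ 2 * (s - 1 / 4))); last first.
    by rewrite ler_wpM2l// sqr_ge0.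
  (* s |-> s^2 / (s - 1/4) is nondecreasing for s >= 1/2, whence the factor
     N - s. *)
  rewrite -subr_ge0.
  have -> : N ^+ 2 * (s - 1 / 4) - s ^+ 2 * (N - 1 / 4) =
    (N - s) * (N * s - (N + s) / 4) by field.
  by apply: mulr_ge0; [lra | nra].
apply: (le_trans (Lambda_k_le_axis _ _ _)) => //.
rewrite ler_level2//; [|lra|lra].
by rewrite bstar2 ler_wpM2l ?sqr_ge0//; lra.
Qed.

Lemma qform_star (c : int * int) :
  qform (1 / 2) bstar c =
  ((c.1 ^+ 2 * n%:Z ^+ 2 + c.2 ^+ 2 - c.1 * c.2)%:~R : R).
Proof.
rewrite /qform exprMn bstar2 /N !(rmorphD, rmorphN, rmorphM, rmorphXn)/=.
by field.
Qed.

(** Four times the form is (2 c2 - c1)^2 + c1^2 (4 n^2 - 1), which exceeds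
    4 n^2 once |c1| >= 2. *)
Lemma unit_coord (c1 c2 : int) :
  c1 ^+ 2 * n%:Z ^+ 2 + c2 ^+ 2 - c1 * c2 <= n%:Z ^+ 2 ->
  c1 = 0 \/ c1 = 1 \/ c1 = -1.
Proof.
move=> h; have [|c14] : (c1 = 0 \/ c1 = 1 \/ c1 = -1) \/ 4 <= c1 ^+ 2 by nia.
  by [].
have n1 : 1 <= n%:Z ^+ 2 by nia.
have sq := sqr_ge0 (2 * c2 - c1).
have : 0 <= (c1 ^+ 2 - 4) * (4 * n%:Z ^+ 2 - 1) by apply: mulr_ge0; lia.
nia.
Qed.

Lemma Lambda_star_lt (c : int * int) :
  Lambda (1 / 2) bstar c.1 c.2 < level bstar N -> c \in axis n.-1.
Proof.
rewrite LambdaE// ltr_level// qform_star N_int ltr_int mem_axis.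
case: c => [c1 c2] /= h.
have c10 : c1 = 0.
  by have [|[|]] := unit_coord (ltW h) => // c11; subst c1; nia.
subst c1; rewrite eqxx /=.
nia.
Qed.

Lemma Lambda_star_eq (c : int * int) :
  (Lambda (1 / 2) bstar c.1 c.2 == level bstar N) =
  (c \in [:: (1, 0); (-1, 0); (1, 1); (-1, -1); (0, n%:Z); (0, - n%:Z)]).
Proof.
rewrite LambdaE// level_eq// qform_star N_int eqr_int.
case: c => [c1 c2] /=; rewrite !inE !xpair_eqE; apply/idP/idP; last by nia.
move=> /eqP h.
have hle : c1 ^+ 2 * n%:Z ^+ 2 + c2 ^+ 2 - c1 * c2 <= n%:Z ^+ 2 by rewrite h.
by have [|[|]] := unit_coord hle => c11; subst c1; nia.
Qed.

Lemma Lambda_k_star k : (n.*2 <= k.+1)%N -> (k <= n.*2)%N ->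
  Lambda_k k (1 / 2) bstar = level bstar N.
Proof.
move=> nk kn; have N1 := N_ge1; apply/eqP; rewrite eq_le; apply/andP; split.
  exact: Lambda_k_le_axis.
apply: (@Lambda_k_ge _ _ _ _ _ (axis n.-1)) => //.
  by rewrite size_axis; lia.
exact: Lambda_star_lt.
Qed.

Lemma F_star : F (1 / 2, bstar).
Proof. by split=> //=; [lra | rewrite bstar2; have := N_ge1; lra]. Qed.

Lemma Lambda_k_has_max k : (n.*2 <= k.+1)%N -> (k <= n.*2)%N ->
  exists2 p : R * R, F p & forall q, F q ->
    Lambda_k k q.1 q.2 <= Lambda_k k p.1 p.2.
Proof.
move=> nk kn.
(* K closes F at a = -1/2 and cuts it at the height of the optimal torus. *)
pose K := (`[- (1 / 2), 1 / 2]%classic `*` `[1 / 2, bstar]%classic) `&`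
  [set p : R * R | 1 <= p.1 ^+ 2 + p.2 ^+ 2].
have FK p : F p -> p.2 <= bstar -> K p.
  move=> Fp pb; have [_ p2] := F_bounds Fp; case: Fp => _ /andP[/ltW l u] h.
  by split; [split; rewrite /= in_itv/= ?l ?p2 | ].
have [||p Kp pmax] := @usc_compact_max _ _
    (fun p : R * R => Lambda_k k p.1 p.2) K _ (@compact_region R bstar).
- by exists (1 / 2, bstar); apply: FK => //; exact: F_star.
- move=> p y [[_ /=]]; rewrite in_itv/= => /andP[p2 _] _.
  by apply: usc_Lambda_k; apply: lt_le_trans p2.
have max_F q : F q -> Lambda_k k q.1 q.2 <= Lambda_k k p.1 p.2.
  move=> Fq; have [qb|/ltW bq] := leP q.2 bstar; first exact/pmax/FK.
  have q0 : 0 < q.2 by case: Fq.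
  apply: le_trans (pmax _ (FK _ F_star (lexx _))) => /=.
  rewrite (Lambda_k_star nk kn); apply: (le_trans (Lambda_k_le_axis _ q0 kn)).
  have N1 := N_ge1; rewrite ler_level2//; [|lra|lra].
  by rewrite ler_wpM2l ?sqr_ge0// ler_pXn2r// nnegrE ltW.
move: Kp => [[/=]]; rewrite !in_itv/= => /andP[p1 p1'] /andP[p2 _] h.
have p0 : 0 < p.2 by lra.
have [p1l|p1l] := ltP (- (1 / 2)) p.1.
  by exists p => //; split=> //; rewrite p1l.
have pE : p.1 = - (1 / 2) by lra.
exists (1 / 2, p.2).
  by split=> //=; [lra | move: h; rewrite pE sqrrN].
move=> q /max_F /le_trans; apply; rewrite pE /=; exact: Lambda_k_opp.
Qed.

End Optimum.

Theorem proposition3p3 (R : realType) (k : nat) (hk : (1 <= k)%N) :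
  let m : int := Num.ceil (k%:R / 2 : R) in
  let b : R := Num.sqrt (m%:~R ^+ 2 - 1 / 4) in
  let F_k : set (R * R) :=
    [set p | F p /\ (m%:~R - 1) ^+ 2 <= p.1 ^+ 2 + p.2 ^+ 2] in
  let tildeLambda : R := 4 * pi ^+ 2 * m%:~R ^+ 2 / b in
  let optimal : set (int * int) :=
    [set c | Lambda (1 / 2) b c.1 c.2 = tildeLambda] in
  [/\ exists p : R * R, F p /\
        is_maximum [set Lambda_k k q.1 q.2 | q in @F R] (Lambda_k k p.1 p.2),
      is_maximum [set Lambda_k k q.1 q.2 | q in F_k] tildeLambda,
      F_k (1 / 2, b) /\ Lambda_k k (1 / 2) b = tildeLambda,
      optimal = [set` [:: (1, 0); (-1, 0); (1, 1); (-1, -1);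
                          (0, m); (0, - m)]]
    & (optimal #= `I_6)%card].
Proof.
rewrite ceil_half; set n := uphalf k.
have n0 : (0 < n)%N by lia.
have nk : (n.*2 <= k.+1)%N by lia.
have kn : (k <= n.*2)%N by lia.
move=> m b F_k tildeLambda optimal.
have star : Lambda_k k (1 / 2) b = tildeLambda := Lambda_k_star n0 nk kn.
have F_k_star : F_k (1 / 2, b).
  split; first exact: F_star.
  rewrite /= sqr_sqrtr; last first.
    have : 1 <= m%:~R ^+ 2 :> R by rewrite expr_ge1// ler1n.
    lra.
  have : 1 <= m%:~R :> R by rewrite ler1n.
  lra.
have optimalE : optimal = [set` [:: (1, 0); (-1, 0); (1, 1); (-1, -1);
    (0, m); (0, - m)]].
  by apply/seteqP; split=> c /=; rewrite -(@Lambda_star_eq R _ n0) => /eqP.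
split=> //.
- have [p Fp pmax] := @Lambda_k_has_max R n n0 k nk kn.
  exists p; split=> //; split; first by exists p.
  by move=> _ [q Fq <-]; exact: pmax.
- split; first by exists (1 / 2, b).
  move=> _ [q [Fq qm] <-]; have [q1 q2] := F_bounds Fq.
  case: Fq => q0 _ q12; exact: (Lambda_k_le_optimum n0 q0 kn q1 q12 qm).
rewrite optimalE; set s := [:: _; _; _; _; _; _].
rewrite (_ : [set` s] = [set` [fset c in s]%fset]).
  apply/card_eq_fsetP; rewrite card_fseq undup_id//.
  by rewrite /s /m /= !inE !xpair_eqE; lia.
by apply/seteqP; split=> c /=; rewrite in_fset.
Qed.
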